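(* Let $\mathbb{F}$ be a field of characteristic different from $2$ and let $c\in\mathbb{F}$. Suppose that all of the following hold: (1) $c\notin\{-1,0,1,1/2,2\}$; (2) $c$ is not a root of any of $x^2+x+1$, $x^2+x-1$, $x^2-x+1$, $x^2-x-1$; (3) $c$ is not a root of $x^2-3x+1$; (4) if $\operatorname{char}(\mathbb{F})\ne3$, then $c\notin\{-1/3,-3,2/3,3/2,1/3,3,4/3,3/4\}$; (5) $c$ is a root of neither $x^2-3x+3$ nor $3x^2-3x+1$; (6) $c$ is a root of neither $x^3+x^2-1$ nor $x^3-x-1$; (7) $c$ is not a root of $x^2+1$; (8) $c$ is a root of neither $x^2-2x+2$ nor $2x^2-2x+1$; (9) $c$ is a root of neither $x^3-x^2+2x-1$ nor $x^3-2x^2+x-1$; (10) $c$ is a root of neither $x^3-2x^2+3x-1$ nor $x^3-3x^2+2x-1$. Then the following list of polynomials in $\mathbb{F}[x]$ is square-free: $x$, $x-1$, $x-c$, $x-1-c$, $x+1-c$, $(1-c)x-c$, $(1+c)x-c$, $g_1(x,c)$, $g_2(x,c)$, $g_3(x,c)$, $g_4(x,c)$, $f_1(x,c)$, $f_2(x,c)$, $f_3(x,c)$, $f_4(x,c)$.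
   Context: Here $g_1(x,c)=x^2+c-2x$, $g_2(x,c)=c^2+x-2c$, $g_3(x,c)=x^2+c-2xc$, $g_4(x,c)=c^2+x-2xc$, $f_1(x,c)=x^2+c^2-xc-x$, $f_2(x,c)=c^2+x^2-xc-c$, $f_3(x,c)=c^2x+xc-x^2-c^2$, $f_4(x,c)=x^2c+xc-x^2-c^2$. A list of polynomials $p_1,\dots,p_k\in\mathbb{F}[x]$ is square-free if there is no sequence $1\le i_1<\dots<i_r\le k$ with $r\ge1$ such that the product $p_{i_1}\cdots p_{i_r}$ is a square in $\bar{\mathbb{F}}[x]$, where $\bar{\mathbb{F}}$ is an algebraic closure of $\mathbb{F}$. *)

(* Defs.v *)
From mathcomp Require Import all_boot all_order all_algebra.
Set Implicit Arguments.
Unset Strict Implicit.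
Unset Printing Implicit Defensive.
Import GRing.Theory.
Local Open Scope ring_scope.

(* Stated over an arbitrary ring so that they can be evaluated in {poly F}
   at x = 'X and at the constant polynomial c%:P. *)
Section TwoVariablePolynomials.
Variable R : comNzRingType.
Implicit Types x c : R.

Definition g1 x c : R := x ^+ 2 + c - 2 * x.
Definition g2 x c : R := c ^+ 2 + x - 2 * c.
Definition g3 x c : R := x ^+ 2 + c - 2 * x * c.
Definition g4 x c : R := c ^+ 2 + x - 2 * x * c.
Definition f1 x c : R := x ^+ 2 + c ^+ 2 - x * c - x.
Definition f2 x c : R := c ^+ 2 + x ^+ 2 - x * c - c.
Definition f3 x c : R := c ^+ 2 * x + x * c - x ^+ 2 - c ^+ 2.
Definition f4 x c : R := x ^+ 2 * c + x * c - x ^+ 2 - c ^+ 2.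

End TwoVariablePolynomials.

(* That Fbar is algebraically closed is carried by its type. *)
Definition algebraic_closure (F : fieldType) (Fbar : closedFieldType)
    (iota : {rmorphism F -> Fbar}) : Prop :=
  forall z : Fbar, algebraicOver iota z.

(* The indices run over 0, ..., size ps - 1, and repetitions in ps count:
   a list with two equal entries is not square-free. *)
Definition square_free (F : fieldType) (Fbar : closedFieldType)
    (iota : {rmorphism F -> Fbar}) (ps : seq {poly F}) : Prop :=
  ~ exists idx : seq nat,
      [/\ idx != [::], sorted ltn idx, all (fun i => (i < size ps)%N) idx
        & exists q : {poly Fbar},
            map_poly iota (\prod_(i <- idx) ps`_i) = q ^+ 2].

Definition poly_list (F : fieldType) (c : F) : seq {poly F} :=
  let x : {poly F} := 'X in let c : {poly F} := c%:P in
  [:: x; x - 1; x - c; x - 1 - c; x + 1 - c; (1 - c) * x - c; (1 + c) * x - c;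
      g1 x c; g2 x c; g3 x c; g4 x c; f1 x c; f2 x c; f3 x c; f4 x c].

(* Main.v *)
Require Import Defs.
From mathcomp Require Import all_boot all_order all_algebra.
From mathcomp Require Import ring.
Import GRing.Theory.
Local Open Scope ring_scope.

(* If a product of distinct polynomials of the list were a square, then a root
   of its first factor would be either a double root of that factor or a root
   of another factor. So it suffices that all the discriminants and all the
   pairwise resultants are nonzero. As polynomials in c over the integers they
   are, up to sign, products of 2 and of the polynomials which the hypotheses
   exclude (in characteristic 3 linear factors such as 3c + 1 and c + 3 reduce
   to a nonzero constant or to a nonzero multiple of c). This factorization is
   checked by trial division on lists of integer coefficients. *)

(* A list of integers stands for a polynomial in c, constant term first. *)
Fixpoint addp (s t : seq int) : seq int :=
  match s, t with
  | [::], _ => t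
  | _, [::] => s
  | a :: s', b :: t' => a + b :: addp s' t'
  end.

Definition scalep (a : int) (s : seq int) : seq int := [seq a * b | b <- s].

Definition subp (s t : seq int) : seq int := addp s (scalep (-1) t).

Fixpoint mulp (s t : seq int) : seq int :=
  if s is a :: s' then addp (scalep a t) (0 :: mulp s' t) else [::].

(* Long division on lists with the leading coefficient first, returning n
   quotient coefficients. No correctness is claimed: [strip] multiplies back. *)
Fixpoint quop_rev (n : nat) (r d : seq int) : seq int :=
  if n is n'.+1 then
    let t := (head 0 r %/ head 0 d)%Z in
    t :: quop_rev n' (subp (behead r) (scalep t (behead d))) d
  else [::].

Definition quop (r d : seq int) : seq int :=
  rev (quop_rev ((size r).+1 - size d)%N (rev r) (rev d)).

Fixpoint strip (fuel : nat) (r d : seq int) : seq int :=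
  if fuel is k.+1 then
    let q := quop r d in
    if all (pred1 0) (subp r (mulp q d)) then strip k q d else r
  else r.

(** Lists are never normalised, so zeros may trail the sign; the zero polynomial is rejected. *)
Definition is_signp (r : seq int) : bool :=
  if r is a :: s then (a \in [:: 1; -1]) && all (pred1 0) s else false.

Definition factors_over (ds : seq (seq int)) (r : seq int) : bool :=
  is_signp (foldl (fun r d => strip (size r) r d) r ds).

(* (a0, a1, a2) stands for a2 X^2 + a1 X + a0, with a_i in Z[c]. *)
Notation triple := (seq int * seq int * seq int)%type.

(* If just one of a2, b2 vanishes, the formula for two quadratics gives the
   resultant times the other one, a harmless factor; it degenerates to 0 only
   when both vanish. *)
Definition resultantp (p q : triple) : seq int :=
  let: (a0, a1, a2) := p in
  let: (b0, b1, b2) := q in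
  let r01 := subp (mulp a1 b0) (mulp a0 b1) in
  if (a2 == [::]) && (b2 == [::]) then r01 else
  let r02 := subp (mulp a2 b0) (mulp a0 b2) in
  let r12 := subp (mulp a2 b1) (mulp a1 b2) in
  subp (mulp r02 r02) (mulp r12 r01).

(** For a linear entry this is a1^2, so its nonvanishing says that the degree stays one. *)
Definition discriminantp (p : triple) : seq int :=
  let: (a0, a1, a2) := p in subp (mulp a1 a1) (scalep 4 (mulp a2 a0)).

(** Same order as [poly_list]. A vanishing a2 is written [[::]], the form that [resultantp] tests
    for. *)
Definition coefs : seq triple :=
  [:: ([::], [:: 1], [::]);
      ([:: -1], [:: 1], [::]);
      ([:: 0; -1], [:: 1], [::]);
      ([:: -1; -1], [:: 1], [::]);
      ([:: 1; -1], [:: 1], [::]);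
      ([:: 0; -1], [:: 1; -1], [::]);
      ([:: 0; -1], [:: 1; 1], [::]);
      ([:: 0; 1], [:: -2], [:: 1]);
      ([:: 0; -2; 1], [:: 1], [::]);
      ([:: 0; 1], [:: 0; -2], [:: 1]);
      ([:: 0; 0; 1], [:: 1; -2], [::]);
      ([:: 0; 0; 1], [:: -1; -1], [:: 1]);
      ([:: 0; -1; 1], [:: 0; -1], [:: 1]);
      ([:: 0; 0; -1], [:: 0; 1; 1], [:: -1]);
      ([:: 0; 0; -1], [:: 0; 1], [:: -1; 1])].

(** Three blocks: 2 with the linear factors of (1), the linear factors of (4), which need a separate
    argument in characteristic 3, and the nonlinear factors. *)
Definition excluded : seq (seq int) :=
  [:: [:: 2]; [:: 1; 1]; [:: 0; 1]; [:: -1; 1]; [:: -1; 2]; [:: -2; 1]] ++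
  [:: [:: 1; 3]; [:: 3; 1]; [:: -2; 3]; [:: -3; 2];
      [:: -1; 3]; [:: -3; 1]; [:: -4; 3]; [:: -3; 4]] ++
  [:: [:: 1; 1; 1]; [:: -1; 1; 1]; [:: 1; -1; 1]; [:: -1; -1; 1];
      [:: 1; -3; 1]; [:: 3; -3; 1]; [:: 1; -3; 3];
      [:: -1; 0; 1; 1]; [:: -1; -1; 0; 1];
      [:: 1; 0; 1]; [:: 2; -2; 1]; [:: 1; -2; 2];
      [:: -1; 2; -1; 1]; [:: -1; 1; -2; 1];
      [:: -1; 3; -2; 1]; [:: -1; 2; -3; 1]].

Lemma discriminants_factor :
  all (fun p => factors_over excluded (discriminantp p)) coefs.
Proof. by vm_compute. Qed.

Lemma resultants_factor :
  pairwise (fun p q => factors_over excluded (resultantp p q)) coefs.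
Proof. by vm_compute. Qed.

(** * Values of coefficient lists at a point of a field *)

Section Evaluation.
Context {K : fieldType} (c : K).
Implicit Types (s t d r : seq int) (p : triple).

Definition evalp s : K := foldr (fun a y => a%:~R + c * y) 0 s.

Lemma evalp_add s t : evalp (addp s t) = evalp s + evalp t.
Proof.
elim: s t => [|a s IHs] [|b t] /=; rewrite ?add0r ?addr0 //.
by rewrite IHs; ring.
Qed.

Lemma evalp_scale a s : evalp (scalep a s) = a%:~R * evalp s.
Proof. by elim: s => [|b s IHs] /=; rewrite ?mulr0 // IHs; ring. Qed.

Lemma evalp_sub s t : evalp (subp s t) = evalp s - evalp t.
Proof. by rewrite evalp_add evalp_scale mulN1r. Qed.

Lemma evalp_mul s t : evalp (mulp s t) = evalp s * evalp t.
Proof.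
elim: s => [|a s IHs] /=; first by rewrite mul0r.
by rewrite evalp_add evalp_scale /= IHs; ring.
Qed.

Lemma evalp_zeros s : all (pred1 0) s -> evalp s = 0.
Proof. by elim: s => //= a s IHs /andP[/eqP-> /IHs->]; rewrite mulr0 addr0. Qed.

(** Each division that is kept satisfies r = q d exactly, so a nonzero value passes from the
    quotient back to r. *)
Lemma evalp_strip n r d :
  evalp d != 0 -> evalp (strip n r d) != 0 -> evalp r != 0.
Proof.
move=> d_neq0; elim: n r => //= n IHn r.
case: ifP => // /evalp_zeros; rewrite evalp_sub evalp_mul => /subr0_eq-> /IHn.
by move=> q_neq0; rewrite mulf_neq0.
Qed.

Lemma evalp_factors_over ds r :
  (forall d, d \in ds -> evalp d != 0) -> factors_over ds r -> evalp r != 0.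
Proof.
rewrite /factors_over; elim: ds r => [|d ds IHds] r ds_neq0 /=.
  case: r => //= a s /andP[a_sign /evalp_zeros->].
  move: a_sign; rewrite mulr0 addr0 !inE.
  by case/orP => /eqP->; rewrite ?mulrN1z ?oppr_eq0 oner_neq0.
move/IHds => strip_neq0; apply: evalp_strip (strip_neq0 _).
  by apply: ds_neq0; rewrite mem_head.
by move=> e ds_e; apply: ds_neq0; rewrite inE ds_e orbT.
Qed.

Definition quadp p : {poly K} :=
  let: (a0, a1, a2) := p in
  (evalp a2)%:P * 'X^2 + (evalp a1)%:P * 'X + (evalp a0)%:P.

Lemma resultantp_eq0 p q z :
  root (quadp p) z -> root (quadp q) z -> evalp (resultantp p q) = 0.
Proof.
case: p q => [[a0 a1] a2] [[b0 b1] b2]; rewrite !rootE !hornerE /=.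
set pz := (X in X == 0 -> _); set qz := (X in _ -> X == 0 -> _).
move=> /eqP pz0 /eqP qz0 /=; case: ifP => [/andP[/eqP a2E /eqP b2E]|_].
  rewrite evalp_sub !evalp_mul.
  transitivity (evalp a1 * qz - evalp b1 * pz); last by rewrite pz0 qz0; ring.
  by rewrite /pz /qz a2E b2E /=; ring.
rewrite !(evalp_sub, evalp_mul).
set r02 := (X in X * X - _ = 0); set r12 := (X in _ - X * _ = 0).
(* At z the combination a2 q - b2 p equals r12 z + r02, and a1 q - b1 p equals r01 - r12 z^2; the
   multipliers cancel z. *)
transitivity ((r02 - r12 * z) * (evalp a2 * qz - evalp b2 * pz)
              - r12 * (evalp a1 * qz - evalp b1 * pz)).
  by rewrite /pz /qz /r02 /r12; ring.
by rewrite pz0 qz0; ring.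
Qed.

Lemma discriminantp_eq0 p z :
  root (quadp p) z -> root (quadp p)^`() z -> evalp (discriminantp p) = 0.
Proof.
case: p => [[a0 a1] a2]; rewrite !rootE !derivE !hornerE /=.
set pz := (X in X == 0 -> _); set dpz := (X in _ -> X == 0 -> _).
move=> /eqP pz0 /eqP dpz0; rewrite evalp_sub evalp_scale !evalp_mul.
transitivity (dpz * dpz - 4 * evalp a2 * pz); first by rewrite /dpz /pz; ring.
by rewrite pz0 dpz0; ring.
Qed.

(** Guarantees a root over a closed field: only nonzero constants lack one, and a1 = a2 = 0 makes
    the discriminant vanish. *)
Lemma size_quadp_neq1 p : evalp (discriminantp p) != 0 -> size (quadp p) != 1.
Proof.
case: p => [[a0 a1] a2]; apply: contra => /eqP size1.
have a1_eq0 : evalp a1 = 0.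
  have : (quadp (a0, a1, a2))`_1 = 0 by rewrite nth_default ?size1.
  by rewrite /= !(coefD, coefCM, coefXn, coefX, coefC) /= => <-; ring.
have a2_eq0 : evalp a2 = 0.
  have : (quadp (a0, a1, a2))`_2 = 0 by rewrite nth_default ?size1.
  by rewrite /= !(coefD, coefCM, coefXn, coefX, coefC) /= => <-; ring.
by rewrite evalp_sub evalp_scale !evalp_mul a1_eq0 a2_eq0; apply/eqP; ring.
Qed.

End Evaluation.

(** * Passage to the algebraic closure and the criterion for non-squares *)

Lemma evalp_rmorph (K L : fieldType) (h : {rmorphism K -> L}) (c : K) s :
  evalp (h c) s = h (evalp c s).
Proof.
by elim: s => [|a s IHs] /=; rewrite ?rmorph0 // IHs rmorphD rmorphM rmorph_int.
Qed.

Lemma map_quadp (K L : fieldType) (h : {rmorphism K -> L}) (c : K) p :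
  map_poly h (quadp c p) = quadp (h c) p.
Proof.
case: p => [[a0 a1] a2] /=.
by rewrite !evalp_rmorph !(rmorphD, rmorphM, rmorphXn) /= !map_polyC map_polyX.
Qed.

(** At a root z of p the derivative of p r is p'(z) r(z), which is nonzero, whereas a square
    vanishing at z has derivative 0 there. *)
Lemma simple_factor_not_square (K : closedFieldType) (p r q : {poly K}) :
  size p != 1 ->
  (forall z, root p z -> ~~ root p^`() z /\ ~~ root r z) -> p * r <> q ^+ 2.
Proof.
move=> /closed_rootP[z pz] /(_ z pz)[dpz rz] pr_sq.
have qz : root q z.
  have: root (p * r) z by rewrite rootM pz.
  by rewrite pr_sq expr2 rootM orbb.
have : root (p * r)^`() z.
  by rewrite pr_sq expr2 derivM rootE !hornerE (rootP qz) mulr0 mul0r addr0.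
rewrite derivM rootE !hornerE (rootP pz) mul0r addr0 mulf_eq0.
by rewrite -!rootE (negPf dpz) (negPf rz).
Qed.

Lemma poly_listE (F : fieldType) (c : F) :
  poly_list c = [seq quadp c p | p <- coefs].
Proof.
rewrite /poly_list /= /g1 /g2 /g3 /g4 /f1 /f2 /f3 /f4.
by do ![congr cons]; ring.
Qed.

Lemma excluded_neq0 (F : fieldType) (hchar : 2%N \notin [pchar F]) (c : F)
    (h1 : c \notin [:: -1; 0; 1; 1 / 2; 2])
    (h2 : [/\ ~~ root ('X^2 + 'X + 1) c, ~~ root ('X^2 + 'X - 1) c,
              ~~ root ('X^2 - 'X + 1) c & ~~ root ('X^2 - 'X - 1) c])
    (h3 : ~~ root ('X^2 - 3 * 'X + 1) c)
    (h4 : 3%N \notin [pchar F] ->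
          c \notin [:: - (1 / 3); - 3; 2 / 3; 3 / 2; 1 / 3; 3; 4 / 3; 3 / 4])
    (h5 : ~~ root ('X^2 - 3 * 'X + 3) c /\ ~~ root (3 * 'X^2 - 3 * 'X + 1) c)
    (h6 : ~~ root ('X^3 + 'X^2 - 1) c /\ ~~ root ('X^3 - 'X - 1) c)
    (h7 : ~~ root ('X^2 + 1) c)
    (h8 : ~~ root ('X^2 - 2 * 'X + 2) c /\ ~~ root (2 * 'X^2 - 2 * 'X + 1) c)
    (h9 : ~~ root ('X^3 - 'X^2 + 2 * 'X - 1) c /\
          ~~ root ('X^3 - 2 * 'X^2 + 'X - 1) c)
    (h10 : ~~ root ('X^3 - 2 * 'X^2 + 3 * 'X - 1) c /\
           ~~ root ('X^3 - 3 * 'X^2 + 2 * 'X - 1) c) :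
  forall d, d \in excluded -> evalp c d != 0.
Proof.
have two_neq0 : (2 : F) != 0 by apply: contra hchar => two0; rewrite inE two0.
(* Here u is the root -a/b, in the form in which the hypotheses exclude it. *)
have linear_neq0 (a b : int) (u : F) :
    c != u -> b%:~R != 0 :> F -> u * b%:~R = - a%:~R -> evalp c [:: a; b] != 0.
  move=> c_neq b_neq0 ubE; apply: contra c_neq => /eqP /= abE; apply/eqP.
  apply: (mulIf b_neq0); rewrite ubE; apply/eqP; rewrite -addr_eq0 addrC.
  by move: abE; rewrite mulr0 addr0 => ->.
have four_neq0 : (4 : F) != 0.
  by rewrite (_ : 4 = 2 * 2) ?mulf_neq0 //; ring.
move: h1; rewrite !inE !negb_or => /and5P[cN1 c0 c1 c_half c2].
have nonroots_neq0 (ps : seq {poly F}) ds :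
    all (fun p => ~~ root p c) ps ->
    [seq p.[c] | p <- ps] = [seq evalp c d | d <- ds] ->
    all (fun d => evalp c d != 0) ds.
  move=> ps_c psE; rewrite -(all_map (evalp c) (fun y => y != 0)) -psE all_map.
  exact: ps_c.
apply/allP; rewrite !all_cat; apply/and3P; split.
- apply/and5P; split; last (apply/and3P; split=> //).
  + by rewrite /= mulr0 addr0.
  + by apply: linear_neq0 cN1 _ _; rewrite ?oner_neq0 //; ring.
  + by apply: linear_neq0 c0 _ _; rewrite ?oner_neq0 //; ring.
  + by apply: linear_neq0 c1 _ _; rewrite ?oner_neq0 //; ring.
  + by apply: linear_neq0 c_half _ _ => //; field.
  + by apply: linear_neq0 c2 _ _; rewrite ?oner_neq0 //; ring.
- have [three0|three_neq0] := eqVneq (3 : F) 0.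
    (* The residue y modulo 3 is always one of 1, -1, c, -c. *)
    have mod3 d (y z : F) : y != 0 -> evalp c d = y + 3 * z -> evalp c d != 0.
      by move=> y_neq0 ->; rewrite three0 mul0r addr0.
    have N1_neq0 : -1 != 0 :> F by rewrite oppr_eq0 oner_neq0.
    have Nc_neq0 : - c != 0 by rewrite oppr_eq0.
    apply/and5P; split; last (apply/and5P; split=> //).
    - by apply: (mod3 _ 1 c (oner_neq0 _)) => /=; ring.
    - by apply: (mod3 _ c 1 c0) => /=; ring.
    - by apply: (mod3 _ 1 (c - 1) (oner_neq0 _)) => /=; ring.
    - by apply: (mod3 _ (- c) (c - 1) Nc_neq0) => /=; ring.
    - by apply: (mod3 _ (-1) c N1_neq0) => /=; ring.
    - by apply: (mod3 _ c (-1) c0) => /=; ring.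
    - by apply: (mod3 _ (-1) (c - 1) N1_neq0) => /=; ring.
    - by apply: (mod3 _ c (c - 1) c0) => /=; ring.
  have /h4 : 3%N \notin [pchar F] by rewrite inE /= three_neq0.
  rewrite !inE !negb_or => /and5P[n1 n2 n3 n4 /and4P[n5 n6 n7 n8]].
  apply/and5P; split; last (apply/and5P; split=> //).
  - by apply: linear_neq0 n1 _ _ => //; field.
  - by apply: linear_neq0 n2 _ _; rewrite ?oner_neq0 //; ring.
  - by apply: linear_neq0 n3 _ _ => //; field.
  - by apply: linear_neq0 n4 _ _ => //; field.
  - by apply: linear_neq0 n5 _ _ => //; field.
  - by apply: linear_neq0 n6 _ _; rewrite ?oner_neq0 //; ring.
  - by apply: linear_neq0 n7 _ _ => //; field.
  - by apply: linear_neq0 n8 _ _ => //; field.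
- case: h2 h5 h6 h8 h9 h10 => [h2a h2b h2c h2d] [h5a h5b] [h6a h6b] [h8a h8b].
  move=> [h9a h9b] [h10a h10b].
  (* The order is that of the last block of [excluded], so the values agree entry by entry. *)
  apply: (nonroots_neq0 [:: 'X^2 + 'X + 1; 'X^2 + 'X - 1; 'X^2 - 'X + 1;
    'X^2 - 'X - 1; 'X^2 - 3 * 'X + 1; 'X^2 - 3 * 'X + 3; 3 * 'X^2 - 3 * 'X + 1;
    'X^3 + 'X^2 - 1; 'X^3 - 'X - 1; 'X^2 + 1; 'X^2 - 2 * 'X + 2;
    2 * 'X^2 - 2 * 'X + 1; 'X^3 - 'X^2 + 2 * 'X - 1; 'X^3 - 2 * 'X^2 + 'X - 1;
    'X^3 - 2 * 'X^2 + 3 * 'X - 1; 'X^3 - 3 * 'X^2 + 2 * 'X - 1]).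
    by rewrite /= h2a h2b h2c h2d h3 h5a h5b h6a h6b h7 h8a h8b h9a h9b h10a h10b.
  by rewrite /= !hornerE /=; do ![congr cons]; ring.
Qed.

Theorem theorem3p1 (F : fieldType) (Fbar : closedFieldType)
    (iota : {rmorphism F -> Fbar}) (hFbar : algebraic_closure iota)
    (hchar : 2%N \notin [pchar F]) (c : F)
    (h1 : c \notin [:: -1; 0; 1; 1 / 2; 2])
    (h2 : [/\ ~~ root ('X^2 + 'X + 1) c, ~~ root ('X^2 + 'X - 1) c,
              ~~ root ('X^2 - 'X + 1) c & ~~ root ('X^2 - 'X - 1) c])
    (h3 : ~~ root ('X^2 - 3 * 'X + 1) c)
    (h4 : 3%N \notin [pchar F] ->
          c \notin [:: - (1 / 3); - 3; 2 / 3; 3 / 2; 1 / 3; 3; 4 / 3; 3 / 4])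
    (h5 : ~~ root ('X^2 - 3 * 'X + 3) c /\ ~~ root (3 * 'X^2 - 3 * 'X + 1) c)
    (h6 : ~~ root ('X^3 + 'X^2 - 1) c /\ ~~ root ('X^3 - 'X - 1) c)
    (h7 : ~~ root ('X^2 + 1) c)
    (h8 : ~~ root ('X^2 - 2 * 'X + 2) c /\ ~~ root (2 * 'X^2 - 2 * 'X + 1) c)
    (h9 : ~~ root ('X^3 - 'X^2 + 2 * 'X - 1) c /\
          ~~ root ('X^3 - 2 * 'X^2 + 'X - 1) c)
    (h10 : ~~ root ('X^3 - 2 * 'X^2 + 3 * 'X - 1) c /\
           ~~ root ('X^3 - 3 * 'X^2 + 2 * 'X - 1) c) :
  square_free iota (poly_list c).
Proof.
have exc := excluded_neq0 _ hchar _ h1 h2 h3 h4 h5 h6 h7 h8 h9 h10.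
pose d0 : triple := ([::], [::], [::]).
case=> -[|i s] [] // _ i_s_sorted i_s_lt [q].
rewrite big_cons rmorphM /=; move: i_s_lt => /= /andP[i_lt s_lt].
have nthE j : (j < size (poly_list c))%N ->
    map_poly iota (poly_list c)`_j = quadp (iota c) (nth d0 coefs j).
  by rewrite poly_listE size_map => j_lt; rewrite (nth_map d0) ?map_quadp.
have disc_neq0 : evalp (iota c) (discriminantp (nth d0 coefs i)) != 0.
  (* The value lies in the image of F and [iota] is injective, so the hypotheses on c in F
     suffice. *)
  rewrite evalp_rmorph fmorph_eq0; apply: evalp_factors_over _ _ _ exc _.
  exact: (all_nthP d0 discriminants_factor).
rewrite nthE //; apply: simple_factor_not_square.
  exact: size_quadp_neq1.
move=> z iz; split.
  by apply: contra disc_neq0 => /(discriminantp_eq0 _ _ _ iz) ->.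
rewrite rmorph_prod rootE horner_prod prodf_seq_neq0.
apply/allP => j s_j /=; have j_lt := allP s_lt j s_j.
(* Indices increase strictly, so i precedes every other j, as [pairwise] requires. *)
have i_lt_j := allP (order_path_min ltn_trans i_s_sorted) j s_j.
rewrite nthE //; apply/negP => /(resultantp_eq0 _ _ _ _ iz)/eqP.
apply/negP; rewrite evalp_rmorph fmorph_eq0.
apply: evalp_factors_over _ _ _ exc _.
exact: (pairwiseP d0 resultants_factor).
Qed.
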